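(* Let $G$ be a finite simple graph on $n$ vertices. If $G$ has a DET:OLD set, then $n \ge 7$.
   Context: For a graph $G$ and $v\in V(G)$, $N(v)$ is the open neighborhood of $v$. For $S\subseteq V(G)$ write $N_S(v)=N(v)\cap S$. A set $S\subseteq V(G)$ is an error-detecting open-locating-dominating set (DET:OLD set) of $G$ if (1) every vertex $v\in V(G)$ satisfies $|N_S(v)|\ge 2$, and (2) every pair of distinct vertices $u,v\in V(G)$ satisfies $|N_S(u)\setminus N_S(v)|\ge 2$ or $|N_S(v)\setminus N_S(u)|\ge 2$. ''$G$ has a DET:OLD set'' means some $S\subseteq V(G)$ is a DET:OLD set of $G$. *)

(* Defs.v *)
From mathcomp Require Import all_boot.

Set Implicit Arguments.
Unset Strict Implicit.
Unset Printing Implicit Defensive.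

(* A finite simple graph is a vertex type T : finType with an adjacency relation
   e : rel T that is symmetric and irreflexive; both properties are hypotheses
   of the statements about it. *)

Definition open_nbhd (T : finType) (e : rel T) (v : T) : {set T} :=
  [set w | e v w].

Definition nbhd_in (T : finType) (e : rel T) (S : {set T}) (v : T) : {set T} :=
  open_nbhd e v :&: S.

(* Error-detecting open-locating-dominating set. *)
Definition is_det_old (T : finType) (e : rel T) (S : {set T}) : Prop :=
  (forall v : T, 2 <= #|nbhd_in e S v|) /\
  (forall u v : T, u <> v ->
     2 <= #|nbhd_in e S u :\: nbhd_in e S v| \/
     2 <= #|nbhd_in e S v :\: nbhd_in e S u|).

Definition has_det_old (T : finType) (e : rel T) : Prop :=
  exists S : {set T}, is_det_old e S.

(* Main.v *)
(* Enlarging S only enlarges the differences N_S(u) \ N_S(v), so one may take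
   S = V, and the two conditions then depend on G alone.  The graphs with at
   most 6 vertices are finitely many, and an exhaustive computation shows that
   none but the empty one satisfies both conditions. *)

Require Import Defs.
From mathcomp Require Import all_boot.

(** The candidates for an entry depend on its position, so that triangular matrices, with rows of
    increasing length, can be enumerated as well. *)
Fixpoint choices (A : Type) (c : nat -> seq A) (n : nat) : seq (seq A) :=
  if n is m.+1 then [seq rcons s x | s <- choices A c m, x <- c m]
  else [:: [::]].
Arguments choices {A} c n.

Lemma mem_choices (A : eqType) (c : nat -> seq A) (f : nat -> A) (n : nat) :
  (forall i, i < n -> f i \in c i) -> mkseq f n \in choices c n.
Proof.
elim: n => [|n IHn] fc; first by rewrite inE.
rewrite mkseqS; apply: (allpairs_f rcons); last exact: fc.
by apply: IHn => i lt_in; apply: fc; apply: ltnW.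
Qed.

Definition bitseqs : nat -> seq bitseq := choices (fun=> [:: false; true]).

(* A graph on {0, ..., n-1} is encoded by its strictly lower triangular
   adjacency matrix: row j lists the adjacencies of j with 0, ..., j-1.  The
   diagonal falls outside the rows, where nth returns false. *)
Definition graphs : nat -> seq (seq bitseq) := choices bitseqs.

Definition adj (g : seq bitseq) (i j : nat) : bool :=
  if i < j then nth false (nth [::] g j) i else nth false (nth [::] g i) j.

Definition encode (r : rel nat) (n : nat) : seq bitseq :=
  mkseq (fun j => mkseq (fun i => r j i) j) n.

Lemma encode_graphs (r : rel nat) (n : nat) : encode r n \in graphs n.
Proof.
apply: mem_choices => j _; apply: mem_choices => i _.
by case: (r j i).
Qed.

Lemma adj_encode (r : rel nat) (n i j : nat) :
  symmetric r -> irreflexive r -> i < n -> j < n ->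
  adj (encode r n) i j = r i j.
Proof.
move=> r_sym r_irr lt_in lt_jn; rewrite /adj.
case: ltngtP => [lt_ij|lt_ji|->]; rewrite nth_mkseq //.
- by rewrite nth_mkseq // r_sym.
- by rewrite nth_mkseq.
- by rewrite nth_default ?size_mkseq // r_irr.
Qed.

(** Here [S] is the whole vertex set; lists and [count] let [vm_compute] evaluate the conditions. *)
Definition det_oldb (n : nat) (r : rel nat) : bool :=
  let V := iota 0 n in
  let diff i j := count (fun k => r i k && ~~ r j k) V in
  all (fun i => 2 <= count (r i) V) V &&
  all (fun i => all (fun j => [|| i == j, 2 <= diff i j | 2 <= diff j i]) V) V.

(** This allows replacing a relation by its decoded encoding, with which it is known to agree only
    below [n]. *)
Lemma eq_det_oldb (n : nat) (r r' : rel nat) :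
  (forall i j, i < n -> j < n -> r i j = r' i j) ->
  det_oldb n r = det_oldb n r'.
Proof.
move=> eq_r; rewrite /det_oldb.
have lt_V i : i \in iota 0 n -> i < n by rewrite mem_iota.
have eq_diff i j : i < n -> j < n ->
    count (fun k => r i k && ~~ r j k) (iota 0 n) =
    count (fun k => r' i k && ~~ r' j k) (iota 0 n).
  by move=> lt_in lt_jn; apply: eq_in_count => k /lt_V lt_kn; rewrite !eq_r.
congr (_ && _); apply: eq_in_all => i /lt_V lt_in.
  by congr (_ <= _); apply: eq_in_count => k /lt_V; apply: eq_r.
by apply: eq_in_all => j /lt_V lt_jn; rewrite !eq_diff.
Qed.

(** All labelled graphs are tried, without reduction up to isomorphism: $2^{15}$ of them for $n =
    6$. The range starts at 1 because both conditions hold vacuously when there are no vertices. *)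
Lemma no_small_det_oldb :
  all (fun n => all (fun g => ~~ det_oldb n (adj g)) (graphs n)) (iota 1 6).
Proof. by vm_compute. Qed.

Lemma det_old_setT (T : finType) (e : rel T) (S : {set T}) :
  is_det_old e S -> is_det_old e [set: T].
Proof.
have sub_diff u v : #|nbhd_in e S u :\: nbhd_in e S v| <=
    #|nbhd_in e [set: T] u :\: nbhd_in e [set: T] v|.
  apply/subset_leq_card/subsetP => w.
  by rewrite !inE !andbT; case: (w \in S); rewrite ?andbT ?andbF.
case=> deg sep; split=> [v|u v neq_uv].
  by apply: leq_trans (deg v) _; rewrite subset_leq_card ?setIS ?subsetT.
by case: (sep u v neq_uv) => le2; [left | right];
  apply: leq_trans le2 (sub_diff _ _).
Qed.

Lemma card_count_nth (T : finType) (x0 : T) (A : {set T}) :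
  #|A| = count (fun k => nth x0 (enum T) k \in A) (iota 0 #|T|).
Proof.
rewrite -(count_map (nth x0 (enum T)) (mem A)) cardT.
by rewrite -/(mkseq _ _) mkseq_nth cardE enumT -size_filter.
Qed.

Lemma det_old_det_oldb (T : finType) (x0 : T) (e : rel T) :
  is_det_old e [set: T] ->
  det_oldb #|T| (fun i j => e (nth x0 (enum T) i) (nth x0 (enum T) j)).
Proof.
case=> deg sep; pose v := nth x0 (enum T).
apply/andP; split; apply/allP => i.
  move=> _; have := deg (v i); rewrite (card_count_nth _ x0).
  by under eq_count do rewrite !inE andbT.
rewrite mem_iota /= => lt_i; apply/allP => j; rewrite mem_iota /= => lt_j.
have [//|neq_ij /=] := eqVneq i j.
have diffE a b : #|nbhd_in e [set: T] (v a) :\: nbhd_in e [set: T] (v b)| =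
    count (fun k => e (v a) (v k) && ~~ e (v b) (v k)) (iota 0 #|T|).
  by rewrite (card_count_nth _ x0); apply: eq_count => k; rewrite !inE !andbT andbC.
apply/orP; rewrite -!diffE; apply: sep => /eqP.
(* [enum T] has no duplicates, so distinct indices give distinct vertices. *)
by rewrite nth_uniq ?enum_uniq -?cardT // (negbTE neq_ij).
Qed.

Theorem theorem2 (T : finType) (e : rel T)
    (e_sym : symmetric e) (e_irr : irreflexive e)
    (T_nonempty : 0 < #|T|) :
  has_det_old e -> 7 <= #|T|.
Proof.
case=> S /det_old_setT det_e; rewrite leqNgt; apply/negP => lt_T7.
(* This vertex serves as the default value of [nth] on [enum T]. *)
have [x0 _] := card_gt0P T_nonempty.
have := det_old_det_oldb _ x0 _ det_e.
(* The search speaks only of relations of the form [adj g], so [r] must first be put in that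
   form. *)
set r := (X in det_oldb _ X); rewrite -(eq_det_oldb _ (adj (encode r #|T|))).
  apply/negP; move/allP: no_small_det_oldb => /(_ #|T|).
  rewrite mem_iota T_nonempty => /(_ lt_T7)/allP; apply.
  exact: encode_graphs.
by move=> i j; apply: adj_encode => [a b|a]; [apply: e_sym | apply: e_irr].
Qed.
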